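(* Let $m\ge4$ be even, $h=\frac m2$, $f_6(x)=x+x^{2^{h}}+x^{2^m-2^{h}+1}\in\mathbb{F}_{2^m}[x]$, and let $s^\infty$ be the sequence $s_t=\operatorname{Tr}(f_6(\alpha^t+1))$, $t\ge0$. Then the minimal polynomial of $s^\infty$ (generator polynomial of $\mathcal{C}_s$) is $$g_s(x)=\prod_{i\in\Gamma_{(h)}\setminus\{1\}}m_{\alpha^{-(i+2^{h})}}(x)\prod_{\substack{2\le j\le h-2\\ j\text{ even}}}\prod_{i\in\Gamma_{(j)}}m_{\alpha^{-(i+2^{j})}}(x)\cdot m_{\alpha^{-1}}(x)\quad\text{if } m\equiv0\pmod4,$$ $$g_s(x)=\prod_{i\in\Gamma_{(h)}\setminus\{1\}}m_{\alpha^{-(i+2^{h})}}(x)\prod_{\substack{1\le j\le h-2\\ j\text{ odd}}}\prod_{i\in\Gamma_{(j)}}m_{\alpha^{-(i+2^{j})}}(x)\quad\text{if } m\equiv2\pmod4.$$ The linear span is $L_s=m\cdot\frac{2^{m/2+1}-2}{3}$ if $m\equiv0\pmod4$ and $L_s=m\cdot\frac{2^{m/2+1}-4}{3}$ if $m\equiv2\pmod4$. Moreover, $\mathcal{C}_s$ has parameters $[2^m-1,\,2^m-1-L_s,\,d(\mathcal{C}_s)]$ with $2^{(m-2)/2}\le d(\mathcal{C}_s)\le L_s+1$.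
   Context: Let $v=2^m-1$, $\alpha$ a primitive element of $\mathbb{F}_{2^m}$, and $\operatorname{Tr}(x)=\sum_{i=0}^{m-1}x^{2^i}$ the absolute trace from $\mathbb{F}_{2^m}$ to $\mathbb{F}_2$. For a polynomial $F$ over $\mathbb{F}_{2^m}$ the binary sequence $s^\infty=(s_t)_{t\ge0}$ is defined by $s_t=\operatorname{Tr}(F(\alpha^t+1))$; it is periodic with period dividing $v$. Its minimal polynomial $g_s(x)$ is the polynomial $1+c_1x+\dots+c_Lx^L\in\mathbb{F}_2[x]$ of least degree $L$ such that $s_i+c_1s_{i-1}+\dots+c_Ls_{i-L}=0$ for all $i\ge L$; its degree $L_s$ is the linear span of $s^\infty$. $\mathcal{C}_s$ denotes the binary cyclic code of length $v$ with generator polynomial $g_s(x)$. For an integer $i$, $m_{\alpha^i}(x)$ is the minimal polynomial of $\alpha^i$ over $\mathbb{F}_2$. For a positive integer $t$, $\Gamma_{(t)}=\{j:1\le j\le 2^t-1,\ j\text{ odd}\}$. Empty products equal $1$. $d(\mathcal{C})$ denotes minimum Hamming distance. *)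

(* Defs.v *)
From HB Require Import structures.
From mathcomp Require Import all_boot all_order all_algebra all_field.
From Stdlib Require Import ClassicalEpsilon.
Set Implicit Arguments. Unset Strict Implicit. Unset Printing Implicit Defensive.
Import GRing.Theory.
Local Open Scope ring_scope.

Section Defs.
Variable F : finFieldType.

(* canonical embedding of F_2 = {0,1} into F (meaningful when char F = 2) *)
Definition F2toF (c : 'F_2) : F := (nat_of_ord c)%:R.

Definition Tr (m : nat) (x : F) : F := \sum_(i < m) x ^+ (2 ^ i).

Definition is_minpoly2 (beta : F) (p : {poly 'F_2}) : Prop :=
  p \is monic /\ root (map_poly F2toF p) beta /\
  (forall q : {poly 'F_2}, q != 0 -> root (map_poly F2toF q) beta ->
     (size p <= size q)%N).

Definition minpoly2 (beta : F) : {poly 'F_2} :=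
  epsilon (inhabits 0) (is_minpoly2 beta).

Definition is_char_poly (s : nat -> F) (p : {poly 'F_2}) : Prop :=
  p`_0 = 1 /\
  forall i : nat, ((size p).-1 <= i)%N ->
    \sum_(k < size p) F2toF p`_k * s (i - k)%N = 0.

Definition is_seq_minpoly (s : nat -> F) (p : {poly 'F_2}) : Prop :=
  is_char_poly s p /\
  forall q, is_char_poly s q -> (size p <= size q)%N.
End Defs.

Definition cyclic_code (n : nat) (g : {poly 'F_2}) : {set 'rV['F_2]_n} :=
  [set c : 'rV['F_2]_n | g %| rVpoly c].

Definition wt (n : nat) (c : 'rV['F_2]_n) : nat := #|[set i | c 0 i != 0]|.

(* minimum Hamming distance (= minimum nonzero weight for a linear code);
   defaults to n when there is no nonzero codeword *)
Definition min_dist (n : nat) (C : {set 'rV['F_2]_n}) : nat :=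
  \big[minn/n]_(c in C | c != 0) wt c.

(* Main.v *)
Require Import Defs.
From HB Require Import structures.
From mathcomp Require Import all_boot all_order all_algebra all_field.
From mathcomp Require Import zify.
From Stdlib Require Import ClassicalEpsilon.
Set Implicit Arguments. Unset Strict Implicit. Unset Printing Implicit Defensive.
Import GRing.Theory.
Local Open Scope ring_scope.

(* Write y = x + 1. Since Tr y = Tr (y ^ (2 ^ h)), only the last term of f6
   contributes to the trace, and raising it to the power 2 ^ h turns it into
   y ^ (2 ^ (h + 1) - 1), which in characteristic 2 is the sum of all x ^ i with
   i < 2 ^ (h + 1). As Tr (x ^ (2 i)) = Tr (x ^ i), the term of an odd i survives
   modulo 2 exactly when the bit length of i has the parity of h + 1, and
   Tr (x ^ (1 + 2 ^ h)) = 0 because x ^ (1 + 2 ^ h) lies in the subfield of order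
   2 ^ h. The remaining exponents k lie in distinct cyclotomic cosets of size m,
   so s_t is the sum of r ^ (- t) over the distinct conjugates r of the
   alpha ^ (- k). Linear independence of geometric sequences then identifies the
   minimal polynomial, and the zeros with exponents 2 ^ h + 3, 2 ^ h + 5, ...,
   2 ^ (h + 1) - 1 give the BCH bound. *)

(** * Linear independence of geometric sequences *)

Lemma exp_sum_indep (F : fieldType) (I : eqType) (rs : seq I) (b c : I -> F) :
  uniq rs -> {in rs &, injective b} ->
  (forall j, (j < size rs)%N -> \sum_(r <- rs) c r * b r ^+ j = 0) ->
  {in rs, forall r, c r = 0}.
Proof.
move=> Urs inj_b sum0 r r_rs.
(* [P] vanishes at every node except [b r] and has degree below [size rs], so combining the
   relations with its coefficients isolates [c r]. *)
pose P := \prod_(q <- rem r rs) ('X - (b q)%:P).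
have sP : size P = size rs.
  by rewrite size_prod_XsubC size_rem // prednK //; case: (rs) r_rs.
have : \sum_(q <- rs) c q * P.[b q] = 0.
  under eq_bigr => q _ do rewrite horner_coef mulr_sumr.
  rewrite exchange_big big1 //= => j _.
  under eq_bigr => q _ do rewrite mulrCA.
  by rewrite -mulr_sumr sum0 ?mulr0 // -sP.
rewrite (bigD1_seq r) //= [X in _ + X]big1_seq ?addr0 => [|q /andP[qr q_rs]].
  move/eqP; rewrite mulf_eq0 => /orP[/eqP //|].
  rewrite horner_prod prodf_seq_eq0 => /hasP[q q_rs] /=.
  rewrite !hornerE subr_eq0 => /eqP eb.
  move: q_rs; rewrite mem_rem_uniq // inE => /andP[/eqP nqr q_rs].
  by case: nqr; apply: inj_b.
rewrite horner_prod (bigD1_seq q) /= ?rem_uniq ?mem_rem_uniq ?inE ?qr //.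
by rewrite hornerXsubC subrr mul0r mulr0.
Qed.

(** * The binary field inside a field of characteristic 2 *)

Section CharacteristicTwo.
Variables (F : finFieldType) (char2 : 2%N \in [pchar F]).

Lemma natr_odd n : n%:R = (odd n)%:R :> F.
Proof.
have e2 : 2%:R = 0 :> F by apply/eqP; case/andP: char2.
by rewrite -[in LHS](odd_double_half n) natrD -mul2n natrM e2 mul0r addr0.
Qed.

(** The proof of characteristic 2 is an argument so that [F2toF] can receive its ring morphism
    structure as instances. *)
Definition embF2 of 2%N \in [pchar F] := @F2toF F.

Local Notation emb := (embF2 char2).

Lemma embF2_zmod_morphism : zmod_morphism emb.
Proof.
move=> a b; rewrite (oppr_pchar2 (pchar_Fp (isT : prime 2))).
rewrite (oppr_pchar2 char2) /embF2 /F2toF -natrD /=.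
by rewrite [RHS]natr_odd [LHS]natr_odd modn2 oddb.
Qed.

Lemma embF2_monoid_morphism : monoid_morphism emb.
Proof.
split=> // a b; rewrite /embF2 /F2toF -natrM /=.
by rewrite [RHS]natr_odd [LHS]natr_odd modn2 oddb.
Qed.
HB.instance Definition _ := GRing.isZmodMorphism.Build _ _ emb embF2_zmod_morphism.
HB.instance Definition _ := GRing.isMonoidMorphism.Build _ _ emb embF2_monoid_morphism.

Local Notation mapF := (map_poly (@F2toF F)).

Lemma map_F2toFE p : mapF p = map_poly emb p.
Proof. by []. Qed.

Lemma F2_eq1 (c : 'F_2) : c != 0 -> c = 1.
Proof. by case: c => [[|[|]]] //= ? _; apply: val_inj. Qed.

Lemma F2poly_of_fixed (P : {poly F}) :
  (forall i, P`_i ^+ 2 = P`_i) -> exists p : {poly 'F_2}, mapF p = P.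
Proof.
move=> fixP; exists (\poly_(i < size P) (if P`_i == 0 then 0 else 1)).
apply/polyP=> i; rewrite map_F2toFE coef_map coef_poly /=.
case: ltnP => [_|le_i]; last by rewrite rmorph0 nth_default.
case: eqP => [->|/eqP nz]; first by rewrite rmorph0.
by rewrite rmorph1; apply: (mulfI nz); rewrite mulr1 -expr2 fixP.
Qed.

Lemma exprD2X (x y : F) i : (x + y) ^+ (2 ^ i) = x ^+ (2 ^ i) + y ^+ (2 ^ i).
Proof. by apply: exprDn_pchar; rewrite pnatX pnatE ?char2. Qed.

(** Squaring fixes binary coefficients, so the value of [q] at a square is the square of its
    value. *)
Lemma root_frobenius (q : {poly 'F_2}) (b : F) i :
  root (mapF q) b -> root (mapF q) (b ^+ (2 ^ i)).
Proof.
move=> rb; elim: i => [|i IHi]; rewrite ?expr1 // expnSr exprM.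
move: IHi; rewrite !rootE => /eqP e0.
suff -> : (mapF q).[(b ^+ (2 ^ i)) ^+ 2] = (mapF q).[b ^+ (2 ^ i)] ^+ 2.
  by rewrite e0 expr0n.
rewrite -!(pFrobenius_autE char2) -horner_map -map_poly_comp; congr _.[_].
apply: eq_map_poly => c /=; rewrite pFrobenius_autE.
by rewrite /F2toF -natrX; case: c => [[|[|]]].
Qed.

(** * Minimal polynomials as products over conjugates *)

Section MinimalPolynomial.
Variables (b : F) (m : nat).
Hypotheses (m_gt0 : (0 < m)%N) (bm : b ^+ (2 ^ m) = b).
Let conjs := [seq b ^+ (2 ^ i) | i <- iota 0 m].
Let P := \prod_(r <- conjs) ('X - r%:P).

(** Squaring shifts the conjugates cyclically, since [bm] sends the last one back to [b]. *)
Lemma conj_poly_fixed i : P`_i ^+ 2 = P`_i.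
Proof.
suff {2}<- : map_poly (pFrobenius_aut char2) P = P by rewrite coef_map /= pFrobenius_autE.
rewrite map_prod_XsubC /P !big_map.
under eq_bigr => k _ do rewrite /= pFrobenius_autE -exprM -expnSr.
case: m m_gt0 bm => // n _ bn; rewrite -[in LHS](addn1 n) iotaD big_cat big_seq1 /=.
rewrite bn mulrC big_cons expn0 expr1; congr (_ * _).
by rewrite -[1%N]addn0 iotaDl big_map.
Qed.

(** [minpoly2] is chosen by [epsilon], so both existence and uniqueness are required. [P] descends
    to the binary field, and a nonzero binary polynomial with root [b] has all conjugates as roots,
    hence is at least as long. *)
Lemma map_minpoly2 : uniq conjs -> mapF (minpoly2 b) = P.
Proof.
move=> Uc; have [p mp] := F2poly_of_fixed conj_poly_fixed.
have rP : root P b.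
  rewrite root_prod_XsubC; apply/mapP; exists 0%N; rewrite ?expr1 //.
  by rewrite mem_iota.
have minp (q : {poly 'F_2}) : q != 0 -> root (mapF q) b -> (size p <= size q)%N.
  move=> nzq rq; rewrite -(size_map_poly emb p) -(size_map_poly emb q) -!map_F2toFE mp.
  rewrite size_prod_XsubC; apply: max_poly_roots => //.
    by rewrite map_F2toFE map_poly_eq0.
  by apply/allP=> _ /mapP[i _ ->]; apply: root_frobenius.
have p_min : is_minpoly2 b p.
  split; last by split; rewrite ?mp.
  by rewrite -(map_monic emb) -map_F2toFE mp monic_prod_XsubC.
have [p'monic [rp' minp']] :
    is_minpoly2 b (minpoly2 b) by apply: epsilon_spec; exists p.
have [pmonic [rp _]] := p_min.
(* Two monic minimal polynomials have the same size, so a nonzero difference would be a shorter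
   polynomial with root [b]. *)
rewrite -mp; congr (mapF _); apply/eqP; rewrite -subr_eq0; apply/negPn/negP=> nz.
have sz : size (minpoly2 b) = size p.
  by apply/eqP; rewrite eqn_leq minp' ?minp // monic_neq0.
have : root (mapF (minpoly2 b - p)) b.
  by rewrite map_F2toFE rmorphB /= rootE hornerD hornerN -!map_F2toFE (eqP rp) (eqP rp') subr0.
move/(minp _ nz); apply/negP; rewrite -ltnNge.
have pn0 : (0 < size p)%N by rewrite size_poly_gt0 monic_neq0.
rewrite -(prednK pn0) ltnS; apply/leq_sizeP => j; rewrite leq_eqVlt coefB.
case/predU1P=> [<-|lt_j]; last first.
  by rewrite !nth_default ?subrr ?sz // -(prednK pn0).
by rewrite -{1}sz -!lead_coefE (monicP p'monic) (monicP pmonic) subrr.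
Qed.
End MinimalPolynomial.

(** * Linear recurrences of a sequence with prescribed simple roots *)

Section RootList.
Variables (R : seq F) (g : {poly 'F_2}).
Hypotheses (UR : uniq R) (mapg : mapF g = \prod_(r <- R) ('X - r%:P)).

Lemma size_root_list : size g = (size R).+1.
Proof. by rewrite -(size_map_poly emb) -map_F2toFE mapg size_prod_XsubC. Qed.

Lemma root_list_neq0 : g != 0.
Proof. by rewrite -size_poly_gt0 size_root_list. Qed.

Lemma dvdp_root_list q : (g %| q) = all (root (mapF q)) R.
Proof.
rewrite -(dvdp_map emb) -!map_F2toFE mapg; apply/idP/idP=> [dv|rts].
  apply/allP=> r rR; rewrite -dvdp_XsubCl (dvdp_trans _ dv) //.
  by rewrite dvdp_XsubCl root_prod_XsubC.
have [|q' ->] := uniq_roots_prod_XsubC rts; first by rewrite uniq_rootsE.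
exact: dvdp_mull.
Qed.

(** The recurrence of [q] at index [i] says that the sum over [R] of [q(r) * r^-1 ^+ i] is 0;
    independence then forces every [q(r)] to vanish. *)
Lemma is_char_polyP (s : nat -> F) q : 0 \notin R ->
    (forall t, s t = \sum_(r <- R) r^-1 ^+ t) ->
  is_char_poly s q <-> q`_0 = 1 /\ g %| q.
Proof.
move=> R0 sE.
have sumE i : ((size q).-1 <= i)%N ->
    \sum_(k < size q) F2toF F q`_k * s (i - k)%N
      = \sum_(r <- R) (mapF q).[r] * r^-1 ^+ i.
  move=> le_qi; under eq_bigr => k _ do rewrite sE mulr_sumr.
  rewrite exchange_big /= big_seq [RHS]big_seq; apply: eq_bigr => r rR.
  have nz : r != 0 by apply: contraNneq R0 => <-.
  rewrite map_F2toFE horner_coef size_map_poly mulr_suml; apply: eq_bigr => k _.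
  rewrite coef_map -mulrA; congr (_ * _).
  rewrite -{2}(@subnK k i); last first.
    by apply: leq_trans le_qi; rewrite -ltnS (leq_trans (ltn_ord k)) ?leqSpred.
  by rewrite exprD mulrCA -exprMn divff // expr1n mulr1.
rewrite dvdp_root_list; split=> -[q0 H]; split=> //; last first.
  move=> i le_qi; rewrite sumE // big1_seq // => r /andP[_ rR].
  by have /eqP-> := allP H _ rR; rewrite mul0r.
apply/allP=> r rR; rewrite rootE; apply/eqP.
have nz : r^-1 != 0 by rewrite invr_eq0; apply: contraNneq R0 => <-.
(* The recurrence starts at index [(size q).-1]; this nonzero factor moves the start to 0. *)
apply: (mulIf (expf_neq0 (size q).-1 nz)); rewrite mul0r.
apply: (exp_sum_indep (rs := R) (b := fun r => r^-1)
          (c := fun r => (mapF q).[r] * r^-1 ^+ (size q).-1)) => //.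
  by move=> x y _ _; apply: invr_inj.
move=> j _; rewrite -[RHS](H ((size q).-1 + j)%N) ?leq_addr // sumE ?leq_addr //.
by apply: eq_bigr => z _; rewrite -mulrA exprD.
Qed.

(** Characteristic polynomials are multiples of [g], so one of least size is associate to [g], and
    leading coefficients in the binary field are 1. *)
Lemma seq_minpolyP (s : nat -> F) p : 0 \notin R ->
    (forall t, s t = \sum_(r <- R) r^-1 ^+ t) ->
  is_seq_minpoly s p <-> p = g.
Proof.
move=> R0 sE; have charP q := is_char_polyP q R0 sE.
have g0 : g`_0 = 1.
  apply: F2_eq1; rewrite -(fmorph_eq0 emb) -coef_map -map_F2toFE -horner_coef0 -rootE.
  by rewrite mapg root_prod_XsubC.
have ming q : is_char_poly s q -> (size g <= size q)%N.
  case/charP => q0 /dvdp_leq -> //.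
  by apply: contra_eq_neq q0 => ->; rewrite coef0 eq_sym oner_neq0.
have charg : is_char_poly s g by apply/charP.
split=> [[charp minp]|->]; last by split.
have [_ dv] := (charP p).1 charp.
have nzp : p != 0.
  by rewrite -size_poly_gt0 (leq_trans _ (ming _ charp)) ?size_root_list.
have lead1 (q : {poly 'F_2}) : q != 0 -> lead_coef q = 1.
  by move=> nzq; apply: F2_eq1; rewrite lead_coef_eq0.
have /eqp_eq : g %= p by rewrite -dvdp_size_eqp // eqn_leq ming ?minp.
by rewrite !lead1 ?root_list_neq0 // !scale1r => ->.
Qed.
End RootList.
End CharacteristicTwo.

(** * Size and minimum distance of cyclic codes *)

Lemma size_rVpoly (R : nzSemiRingType) n (u : 'rV[R]_n) :
  (size (rVpoly u) <= n)%N.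
Proof. exact: size_poly. Qed.

(** Multiplication by [g] is a bijection from polynomials of size at most [n - (size g).-1] onto the
    multiples of [g] of size at most [n]. *)
Lemma card_poly_multiples (K : finFieldType) n (g : {poly K}) :
    g != 0 -> (size g <= n.+1)%N ->
  #|[set c : 'rV[K]_n | g %| rVpoly c]| = (#|K| ^ (n - (size g).-1))%N.
Proof.
move=> nzg le_gn; have g_gt0 : (0 < size g)%N by rewrite size_poly_gt0.
have [k kE] : exists k, k = (n - (size g).-1)%N by eexists.
rewrite -kE; pose f (u : 'rV[K]_k) : 'rV_n := poly_rV (rVpoly u * g).
have fK (u : 'rV[K]_k) : rVpoly (f u) = rVpoly u * g.
  by apply: poly_rV_K; have := size_polyMleq (rVpoly u) g; have := size_rVpoly u; lia.
have inj_f : injective f.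
  move=> u w /(congr1 rVpoly); rewrite !fK => /(mulIf nzg).
  exact: (can_inj rVpolyK).
rewrite (_ : [set c | _] = f @: [set: 'rV_k]).
  by rewrite card_imset // cardsT card_mx mul1n.
apply/setP=> c; rewrite inE; apply/idP/imsetP=> [dv|[u _ ->]]; last first.
  by rewrite fK dvdp_mull.
exists (poly_rV (rVpoly c %/ g)); rewrite ?inE //.
apply: (can_inj rVpolyK); rewrite fK poly_rV_K ?divpK //.
by rewrite size_divp // kE leq_sub2r // size_rVpoly.
Qed.

Lemma card_cyclic_code n (g : {poly 'F_2}) : g != 0 -> (size g <= n.+1)%N ->
  #|cyclic_code n g| = (2 ^ (n - (size g).-1))%N.
Proof. by move=> nzg le_gn; rewrite card_poly_multiples // card_Fp. Qed.

Lemma min_dist_le n (C : {set 'rV['F_2]_n}) c :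
  c \in C -> c != 0 -> (min_dist C <= wt c)%N.
Proof.
move=> cC nz; rewrite /min_dist; have := mem_index_enum c.
elim: (index_enum _) => // a r IHr; rewrite inE big_cons.
case: eqP => [<- _|_ /= /IHr IH]; first by rewrite cC nz geq_minl.
by case: ifP => // _; rewrite geq_min IH orbT.
Qed.

(** The bound [d <= n] covers the default value of the minimum. *)
Lemma min_dist_ge n (C : {set 'rV['F_2]_n}) d : (d <= n)%N ->
  {in C, forall c, c != 0 -> (d <= wt c)%N} -> (d <= min_dist C)%N.
Proof.
move=> le_dn wtC; rewrite /min_dist.
elim/big_ind: _ => // [x y dx dy|c /andP[cC nz]]; last exact: wtC.
by rewrite leq_min dx.
Qed.

(** The polynomial [g] is itself a nonzero codeword, supported on its [size g] coefficients. *)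
Lemma min_dist_cyclic_le n (g : {poly 'F_2}) : g != 0 -> (size g <= n)%N ->
  (min_dist (cyclic_code n g) <= size g)%N.
Proof.
move=> nzg le_gn; have gK : rVpoly (poly_rV g : 'rV_n) = g by apply: poly_rV_K.
apply: leq_trans (min_dist_le (c := poly_rV g) _ _) _; rewrite ?inE ?gK //.
  by apply: contraNneq nzg => e; rewrite -gK e linear0.
rewrite -[X in (_ <= X)%N]card_ord /wt.
apply: leq_trans (leq_imset_card (widen_ord le_gn) predT).
apply: subset_leq_card; apply/subsetP=> i; rewrite inE => nz.
have lt_ig : (i < size g)%N.
  by rewrite ltnNge; apply: contra nz => le_gi; rewrite mxE nth_default.
by apply/imsetP; exists (Ordinal lt_ig) => //; apply: val_inj.
Qed.

(** If the weight of [c] were below [d], the prescribed zeros would give at least as many relations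
    as there are positions [i] in the support. The nodes [b ^+ i] are distinct, so independence
    kills every coefficient. *)
Lemma bch_bound (F : finFieldType) (a b : F) n d (g : {poly 'F_2}) :
    2%N \in [pchar F] -> a != 0 -> n.-primitive_root b ->
    (forall j, (j < d.-1)%N -> root (map_poly (@F2toF F) g) (a * b ^+ j)) ->
  {in cyclic_code n g, forall c, c != 0 -> (d <= wt c)%N}.
Proof.
move=> char2 nza prim_b rg c; rewrite inE => dv nzc; rewrite leqNgt.
apply: contra nzc => lt_wd; apply/eqP/rowP=> i; rewrite mxE.
case: (eqVneq (c 0 i) 0) => // nzi.
pose rs := enum [set i | c 0 i != 0].
have sz_rs : size rs = wt c by rewrite -cardE.
have in_rs j : (j \in rs) = (c 0 j != 0) by rewrite mem_enum inE.
have: F2toF F (c 0 i) * a ^+ i = 0.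
  apply: (exp_sum_indep (rs := rs) (b := fun i : 'I_n => b ^+ i)
            (c := fun i => F2toF F (c 0 i) * a ^+ i)); rewrite ?in_rs ?enum_uniq //.
    move=> x y _ _ /eqP; rewrite (eq_prim_root_expr prim_b) !modn_small //.
    by move/eqP/val_inj.
  move=> j; rewrite sz_rs => lt_j.
  have /rg rj : (j < d.-1)%N by lia.
  have dvF : map_poly (embF2 char2) g %| map_poly (embF2 char2) (rVpoly c).
    by rewrite dvdp_map.
  have : root (map_poly (embF2 char2) (rVpoly c)) (a * b ^+ j).
    by rewrite -dvdp_XsubCl (dvdp_trans _ dvF) // dvdp_XsubCl.
  rewrite rootE => /eqP.
  rewrite (horner_coef_wide (n := n)); last by rewrite size_map_poly size_rVpoly.
  under eq_bigr => k _ do rewrite coef_map coef_rVpoly_ord exprMn exprAC mulrA.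
  move=> cj0; rewrite -[RHS]cj0.
  rewrite big_enum_cond /= [RHS](bigID (fun k => c 0 k != 0)) /=.
  rewrite [X in _ = _ + X]big1 ?addr0 => [|k]; last first.
    by rewrite negbK => /eqP->; rewrite rmorph0 !mul0r.
  by apply: eq_bigl => k; rewrite inE andbT.
move/eqP; rewrite mulf_eq0 expf_eq0 (negPf nza) andbF orbF.
by rewrite (F2_eq1 nzi) /F2toF /= oner_eq0.
Qed.

(** * Odd exponents sorted by bit length *)

Definition odds a n := [seq i <- index_iota a (2 ^ n) | odd i].

(* The odd numbers [k < 2 ^ n] whose bit length has the parity of [n]. *)
Fixpoint expo n : seq nat :=
  if n is n'.+1 then
    if n' is n''.+1 then [seq (i + 2 ^ n')%N | i <- odds 1 n'] ++ expo n''
    else [:: 1%N]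
  else [::].

(** For [1 < h] this is [expo h.+1] without [1 + 2 ^ h], the exponent whose trace term vanishes. *)
Definition leaders h := [seq (i + 2 ^ h)%N | i <- odds 3 h] ++ expo h.-1.

Lemma nat_ind2 (P : nat -> Prop) :
  P 0%N -> P 1%N -> (forall n, P n -> P n.+2) -> forall n, P n.
Proof.
move=> P0 P1 IH n; suff [] : P n /\ P n.+1 by [].
by elim: n => [|n [Pn PSn]]; split=> //; apply: IH.
Qed.

Lemma expoSS n : expo n.+2 = [seq (i + 2 ^ n.+1)%N | i <- odds 1 n.+1] ++ expo n.
Proof. by []. Qed.

Lemma expo_leaders h : (1 < h)%N -> expo h.+1 = (1 + 2 ^ h)%N :: leaders h.
Proof.
case: h => [|[|h]] // _; rewrite expoSS /leaders /=.
rewrite /odds /index_iota expnS -[(2 * _ - 1)%N]/(2 * 2 ^ h.+1 - 1)%N.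
have e_gt1 : (1 < 2 ^ h.+1)%N by rewrite -{1}(expn0 2) ltn_exp2l.
by rewrite (_ : 2 * 2 ^ h.+1 - 1 = (2 * 2 ^ h.+1 - 3).+2)%N //; lia.
Qed.

Lemma mem_expo n k : k \in expo n -> odd k /\ (k < 2 ^ n)%N.
Proof.
elim/nat_ind2: n k => [k|k|n IHn k] //; first by rewrite inE => /eqP->.
rewrite expoSS mem_cat => /orP[/mapP[i]|/IHn[]].
  rewrite mem_filter mem_index_iota => /and3P[oi _ lti] ->.
  by rewrite oddD oddX oi /= [X in (_ < X)%N]expnS; split=> //; lia.
by move=> ok ltk; rewrite !expnS; split=> //; lia.
Qed.

Lemma uniq_expo n : uniq (expo n).
Proof.
elim/nat_ind2: n => [//|//|n IHn]; rewrite expoSS cat_uniq IHn andbT.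
rewrite map_inj_uniq; last by move=> i j /addIn.
rewrite filter_uniq ?iota_uniq //=; apply/hasPn=> k /mem_expo[_ ltk]; apply/negP=> /mapP[i _ kE].
by move: ltk; rewrite kE expnS; lia.
Qed.

Lemma sum_even_odd (V : zmodType) (G : nat -> V) n :
  \sum_(0 <= i < n.*2) G i
    = \sum_(0 <= i < n) G i.*2 + \sum_(0 <= i < n.*2 | odd i) G i.
Proof.
elim: n => [|n IHn]; first by rewrite !big_geq ?addr0.
rewrite doubleS !big_nat_recr //= IHn ![\sum_(0 <= i < _.+2 | _) _]big_mkcond.
rewrite !big_nat_recr //= odd_double /= -big_mkcond addr0.
by rewrite -!addrA; congr (_ + _); rewrite addrCA.
Qed.

Lemma size_odds n : size (odds 1 n.+1) = (2 ^ n)%N.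
Proof.
have cnt k : (\sum_(0 <= i < k.*2 | odd i) 1 = k)%N.
  elim: k => [|k IHk]; first by rewrite big_geq.
  rewrite doubleS big_mkcond !big_nat_recr //= -big_mkcond IHk odd_double /=.
  by rewrite addn0 addn1.
rewrite /odds size_filter -sum1_count -[RHS]cnt -mul2n -expnS.
by rewrite [RHS]big_ltn_cond ?expn_gt0.
Qed.

(** The count is [(2 ^ n + 1) / 3] for odd [n] and [(2 ^ n - 1) / 3] for even [n], stated free of
    division and subtraction. *)
Lemma size_expo n : (size (expo n) * 3 + ~~ odd n = 2 ^ n + odd n)%N.
Proof.
elim/nat_ind2: n => [//|//|n IHn]; rewrite expoSS size_cat size_map size_odds /= negbK.
by rewrite !expnS; lia.
Qed.

(** Even indices below [2 ^ k.+1] reproduce the sum below [2 ^ k]. Halving twice counts the odd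
    indices below [2 ^ n.+1] twice, so they cancel, leaving the odd ones of bit length [n.+2] and
    the sum below [2 ^ n]. *)
Lemma sum_expo (V : zmodType) (T : nat -> V) n :
    (forall x : V, x + x = 0) -> T 0%N = 0 -> (forall i, T i.*2 = T i) ->
  \sum_(0 <= i < 2 ^ n) T i = \sum_(k <- expo n) T k.
Proof.
move=> add2 T0 Tdouble.
have halve k : \sum_(0 <= i < 2 ^ k.+1) T i
    = \sum_(0 <= i < 2 ^ k) T i + \sum_(0 <= i < 2 ^ k.+1 | odd i) T i.
  by rewrite expnS mul2n sum_even_odd (eq_bigr T).
elim/nat_ind2: n => [||n IHn].
- by rewrite big_nat1 big_nil.
- by rewrite expn1 !big_nat_recr //= big_geq // T0 !add0r big_seq1.
rewrite halve halve IHn expoSS big_cat big_map -addrA [RHS]addrC; congr (_ + _).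
rewrite [X in _ + X](@big_cat_nat _ _ _ (2 ^ n.+1)) //=; last by rewrite leq_exp2l.
rewrite addrA add2 add0r -{1}[(2 ^ n.+1)%N]add0n big_addn.
rewrite (_ : 2 ^ n.+2 - 2 ^ n.+1 = 2 ^ n.+1)%N; last by rewrite [X in (X - _)%N]expnS; lia.
rewrite big_filter big_mkcond big_ltn ?expn_gt0 //= oddX add0r -big_mkcond.
by apply: eq_bigl => i; rewrite oddD oddX addbF.
Qed.

(** Block [j] holds the odd numbers of bit length [j + 1], so [j] has the parity opposite to [n];
    for odd [n] bit length one gives the lone factor [phi 1]. *)
Lemma prod_expo (R : comPzRingType) (phi : nat -> R) n :
  \prod_(k <- expo n) phi k =
    if odd n then
      (\prod_(2 <= j < n | ~~ odd j) \prod_(1 <= i < 2 ^ j | odd i) phi (i + 2 ^ j)%N)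
      * phi 1%N
    else \prod_(1 <= j < n | odd j) \prod_(1 <= i < 2 ^ j | odd i) phi (i + 2 ^ j)%N.
Proof.
have recr a b (P : pred nat) (Q : nat -> R) : (a <= b)%N ->
    \prod_(a <= j < b.+1 | P j) Q j
      = \prod_(a <= j < b | P j) Q j * (if P b then Q b else 1).
  by move=> le_ab; rewrite big_mkcond big_nat_recr //= -big_mkcond.
elim/nat_ind2: n => [||n IHn].
- by rewrite big_nil !big_geq.
- by rewrite big_seq1 !big_geq ?mul1r.
rewrite expoSS big_cat big_map big_filter IHn [LHS]mulrC.
have -> : odd n.+2 = odd n by rewrite /= negbK.
case: ifP => on.
  rewrite recr; last by case: n on {IHn}.
  rewrite oddS on [LHS]mulrAC; congr (_ * _ * _).
  case: n on {IHn} => [|[|n]] // on.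
  by rewrite [RHS]recr // on mulr1.
rewrite recr // oddS on; congr (_ * _).
case: n on {IHn} => [|n] on; first by rewrite !big_geq.
by rewrite [RHS]recr // on mulr1.
Qed.

(** * Cyclotomic cosets modulo [2 ^ h.*2 - 1] *)

Lemma mul_expn2_mod k m : k * 2 ^ m = k %[mod 2 ^ m - 1].
Proof.
rewrite -{1}(@subnK 1 (2 ^ m)) ?expn_gt0 // mulnDr muln1 addnC.
by rewrite -modnDmr modnMl addn0.
Qed.

(** A shift below [h] keeps the product below [2 ^ h.*2]. For [d > 0] it is even, hence differs from
    the odd modulus and needs no reduction, and it cannot equal the odd [k']. *)
Lemma coset_small h k k' d : (1 < h)%N -> odd k -> odd k' ->
    (k < 2 ^ h.+1)%N -> (k' < 2 ^ h.+1)%N -> (d < h)%N ->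
    k * 2 ^ d = k' %[mod 2 ^ h.*2 - 1] ->
  k = k' /\ d = 0%N.
Proof.
move=> h_gt1 ok ok' ltk ltk' ltd.
have h2 : (2 ^ h.+1 <= 2 ^ h.*2 - 1)%N.
  have : (2 ^ h.+2 <= 2 ^ h.*2)%N by rewrite leq_exp2l //; lia.
  by rewrite [(2 ^ h.+2)%N]expnS; have := expn_gt0 2 h.+1; lia.
rewrite [RHS]modn_small; last by lia.
case: d ltd => [|d] ltd; first by rewrite muln1 modn_small //; lia.
have le2 : (k * 2 ^ d.+1 < 2 ^ h.*2)%N.
  apply: (@leq_trans (2 ^ h.+1 * 2 ^ d.+1)); first by rewrite ltn_pmul2r ?expn_gt0.
  by rewrite -expnD leq_exp2l //; lia.
have od : odd (2 ^ h.*2 - 1) by rewrite oddB ?expn_gt0 // oddX; case: (h) h_gt1.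
have ek : ~~ odd (k * 2 ^ d.+1) by rewrite oddM oddX andbF.
rewrite modn_small; last by lia.
by move=> kE; rewrite kE ok' in ek.
Qed.

Lemma coset_inj_ord h k k' d : (1 < h)%N -> odd k -> odd k' ->
    (k < 2 ^ h.+1)%N -> (k' < 2 ^ h.+1)%N -> k != (1 + 2 ^ h)%N -> (d < h.*2)%N ->
    k * 2 ^ d = k' %[mod 2 ^ h.*2 - 1] ->
  k = k' /\ d = 0%N.
Proof.
move=> h_gt1 ok ok' ltk ltk' nk ltd kE.
case: (ltnP d h) => [lt_dh|le_hd]; first exact: (coset_small h_gt1).
(* Multiplying by [2 ^ (h.*2 - d)] exchanges [k] and [k'] and makes the shift at most [h]. *)
have {}kE : k' * 2 ^ (h.*2 - d) = k %[mod 2 ^ h.*2 - 1].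
  rewrite -modnMml -kE modnMml -mulnA -expnD subnKC; last exact: ltnW.
  exact: mul_expn2_mod.
case: (ltnP (h.*2 - d) h) => [lt|ge].
  have [_ /eqP] := coset_small h_gt1 ok' ok ltk' ltk lt kE.
  by rewrite subn_eq0 leqNgt ltd.
have dE : (h.*2 - d = h)%N.
  by apply/eqP; rewrite eqn_leq ge andbT leq_subLR -addnn leq_add2r.
move: kE nk; rewrite dE.
(* The shift is now exactly [h]. With [N = 2 ^ h], multiplication by [N] modulo [N * N - 1] swaps
   the two digits in base [N]. *)
have N_gt3 : (3 < 2 ^ h)%N by apply: (@leq_trans (2 ^ 2)); rewrite ?leq_exp2l.
have eN : ~~ odd (2 ^ h) by rewrite oddX; case: (h) h_gt1.
move: ltk ltk'; rewrite -addnn expnD !expnS.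
move: (2 ^ h)%N N_gt3 eN => N N_gt3 eN ltk ltk'.
have NN : (4 * N <= N * N)%N by rewrite leq_mul2r N_gt3 orbT.
rewrite [in X in _ = X -> _]modn_small; last by lia.
case: (ltnP k' N) => [lt_kN|le_Nk].
  have : (k'.+1 * N <= N * N)%N by rewrite leq_mul2r lt_kN orbT.
  rewrite mulSn => kN; rewrite modn_small; last by lia.
  by move=> kE; move: ok; rewrite -kE oddM (negPf eN) andbF.
(* [N + r] goes to [1 + r * N]. As [k < 2 * N], only [r = 0], where [k'] is even, and [r = 1], where
   [k] is the excluded [1 + 2 ^ h], could occur. *)
have [r rE] : exists r, k' = (N + r)%N by exists (k' - N)%N; lia.
have ltr : (r < N)%N by lia.
have : (r.+1 * N <= N * N)%N by rewrite leq_mul2r ltr orbT.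
have -> : (k' * N = (N * N - 1) + (1 + r * N))%N by rewrite rE mulnDl; lia.
rewrite mulSn modnDl => rN; rewrite modn_small; last by lia.
move=> kE; move: ltk ok; rewrite -kE; case: r rE {ltr rN kE} => [|[|r]] rE.
- by move: ok'; rewrite rE addn0 (negPf eN).
- by rewrite mul1n eqxx.
- by rewrite !mulSn; lia.
Qed.

Lemma coset_inj h k k' i i' : (1 < h)%N ->
    k \in leaders h -> k' \in leaders h -> (i < h.*2)%N -> (i' < h.*2)%N ->
    k * 2 ^ i = k' * 2 ^ i' %[mod 2 ^ h.*2 - 1] ->
  k = k' /\ i = i'.
Proof.
move=> h_gt1.
wlog le_i : k k' i i' / (i' <= i)%N => [IH kK kK' lti lti' E|].
  case: (leqP i' i) => [le|/ltnW le]; first exact: IH.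
  by have [] := IH k' k i' i le kK' kK lti' lti (esym E).
move=> kK kK' lti lti' E.
have mem k0 : k0 \in leaders h ->
    [/\ odd k0, (k0 < 2 ^ h.+1)%N & k0 != (1 + 2 ^ h)%N].
  move=> k0K; have k0E : k0 \in expo h.+1 by rewrite expo_leaders // inE k0K orbT.
  have [ok0 ltk0] := mem_expo k0E; split=> //.
  have := uniq_expo h.+1; rewrite expo_leaders //= => /andP[nK _].
  by apply: contraNneq nK => <-.
have [ok ltk nk] := mem _ kK; have [ok' ltk' nk'] := mem _ kK'.
have {}E : k * 2 ^ (i - i') = k' %[mod 2 ^ h.*2 - 1].
  (* The factor [2 ^ (h.*2 - i')] inverts [2 ^ i'] modulo [2 ^ h.*2 - 1]. *)
  move/(congr1 (fun z => (z * 2 ^ (h.*2 - i')) %% (2 ^ h.*2 - 1))%N): E.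
  rewrite !modnMml -!mulnA -!expnD subnKC ?(ltnW lti') // mul_expn2_mod.
  rewrite addnBA ?(ltnW lti') // addnC -addnBA // addnC expnD mulnA.
  by rewrite mul_expn2_mod.
have lt_d : (i - i' < h.*2)%N by apply: leq_ltn_trans (leq_subr _ _) lti.
have [-> /eqP] := coset_inj_ord h_gt1 ok ok' ltk ltk' nk lt_d E.
by rewrite subn_eq0 => le_i'; split=> //; apply/eqP; rewrite eqn_leq le_i le_i'.
Qed.

(** * The trace and the expansion of the sequence *)

Section Trace.
Variables (F : finFieldType) (char2 : 2%N \in [pchar F]).

(** Induction by doubling: the new factor [(x + 1) ^+ (2 ^ n)] is [x ^+ (2 ^ n) + 1], which appends
    a shifted copy of the sum. *)
Lemma geom_sum_char2 (x : F) n :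
  (x + 1) ^+ (2 ^ n - 1) = \sum_(0 <= i < 2 ^ n) x ^+ i.
Proof.
elim: n => [|n IHn]; first by rewrite big_nat1.
have -> : (2 ^ n.+1 - 1 = (2 ^ n - 1) + 2 ^ n)%N.
  by rewrite expnS; have := expn_gt0 2 n; lia.
rewrite exprD IHn (exprD2X char2) expr1n mulrDr mulr1 addrC.
rewrite expnS mul2n -addnn [RHS](@big_cat_nat _ _ _ (2 ^ n)) ?leq_addr //=.
congr (_ + _); rewrite mulr_suml -[X in _ = \sum_(X <= _ < _) _]add0n big_addn addnK.
by apply: eq_bigr => i _; rewrite exprD.
Qed.

Variables (m : nat).
Hypothesis cardF : #|F| = (2 ^ m)%N.

Lemma expF_card (x : F) : x ^+ (2 ^ m) = x.
Proof. by rewrite -cardF expf_card. Qed.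

Lemma TrD (x y : F) : Tr m (x + y) = Tr m x + Tr m y.
Proof. by rewrite -big_split; apply: eq_bigr => i _; rewrite (exprD2X char2). Qed.

Lemma Tr0 : Tr m 0 = 0 :> F.
Proof. by rewrite /Tr big1 // => i _; rewrite expr0n expn_eq0. Qed.

Lemma Tr_sum (I : Type) (r : seq I) (G : I -> F) :
  Tr m (\sum_(i <- r) G i) = \sum_(i <- r) Tr m (G i).
Proof. by apply: big_morph; [apply: TrD | apply: Tr0]. Qed.

(** The sum of the first [m.+1] conjugates is split at either end; the last conjugate is again
    [x]. *)
Lemma Tr_sqr (x : F) : Tr m (x ^+ 2) = Tr m x.
Proof.
have e1 : \sum_(i < m.+1) x ^+ (2 ^ i) = Tr m x + x.
  by rewrite big_ord_recr /= expF_card.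
have e2 : \sum_(i < m.+1) x ^+ (2 ^ i) = x + Tr m (x ^+ 2).
  rewrite big_ord_recl expn0 expr1; congr (_ + _); apply: eq_bigr => i _.
  by rewrite -exprM -expnS.
by apply: (addrI x); rewrite -e2 e1 addrC.
Qed.

Lemma Tr_frobenius (x : F) n : Tr m (x ^+ (2 ^ n)) = Tr m x.
Proof. by elim: n => [|n IHn]; rewrite ?expr1 // expnSr exprM Tr_sqr. Qed.

Variables (h : nat).
Hypothesis mE : m = h.*2.

(** The two halves of the trace sum coincide and cancel. *)
Lemma Tr_subfield (x : F) : x ^+ (2 ^ h) = x -> Tr m x = 0.
Proof.
move=> xh; rewrite /Tr mE -addnn big_split_ord /=.
under [X in _ + X]eq_bigr => i _ do rewrite expnD exprM xh.
exact: addrr_pchar2.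
Qed.

Lemma Tr_f6 (x : F) : (1 < h)%N ->
  Tr m (x + 1 + (x + 1) ^+ (2 ^ h) + (x + 1) ^+ (2 ^ m - 2 ^ h + 1))
    = \sum_(k <- leaders h) Tr m (x ^+ k).
Proof.
move=> h_gt1; rewrite 2!TrD Tr_frobenius addrr_pchar2 // add0r.
rewrite -(Tr_frobenius _ h).
have -> : ((x + 1) ^+ (2 ^ m - 2 ^ h + 1)) ^+ (2 ^ h) = (x + 1) ^+ (2 ^ h.+1 - 1).
  move: (x + 1) => y.
  (* After multiplication by [2 ^ h] the first summand carries the factor [2 ^ m], which acts
     trivially; the exponent left is [(2 ^ h - 1) + 2 ^ h]. *)
  have -> : (2 ^ m - 2 ^ h + 1 = 2 ^ h * (2 ^ h - 1) + 1)%N.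
    by rewrite mE -addnn expnD mulnBr muln1.
  rewrite exprAC exprD exprM expr1 -[(y ^+ _) ^+ (2 ^ h)]exprM -expnD addnn -mE.
  rewrite expF_card -exprD; congr (_ ^+ _).
  by rewrite expnS; have := expn_gt0 2 h; lia.
rewrite geom_sum_char2 Tr_sum (@sum_expo _ (fun k => Tr m (x ^+ k))).
- rewrite expo_leaders // big_cons [X in X + _]Tr_subfield ?add0r //.
  rewrite exprD expr1 exprMn -exprM -expnD addnn -mE expF_card mulrC //.
- exact: addrr_pchar2.
- by rewrite expr0 Tr_subfield // expr1n.
- by move=> i; rewrite -muln2 exprM Tr_sqr.
Qed.
End Trace.

(** * Products over the exponents and their number *)

Lemma prod_leaders (R : comPzRingType) (phi : nat -> R) h : (1 < h)%N ->
  \prod_(k <- leaders h) phi k =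
    if odd h then
      (\prod_(3 <= i < 2 ^ h | odd i) phi (i + 2 ^ h)%N)
      * (\prod_(1 <= j < h.-1 | odd j)
           \prod_(1 <= i < 2 ^ j | odd i) phi (i + 2 ^ j)%N)
    else
      (\prod_(3 <= i < 2 ^ h | odd i) phi (i + 2 ^ h)%N)
      * (\prod_(2 <= j < h.-1 | ~~ odd j)
           \prod_(1 <= i < 2 ^ j | odd i) phi (i + 2 ^ j)%N)
      * phi 1%N.
Proof.
case: h => // h _; rewrite /leaders big_cat big_map big_filter prod_expo oddS.
by case: (odd h); rewrite //= mulrA.
Qed.

(** Dropping [1 + 2 ^ h] lowers the count for [expo h.+1] by one, that is, its numerator by 3. *)
Lemma size_leaders h : (1 < h)%N ->
  size (leaders h) =
    (if odd h then (2 ^ (h + 1) - 4) %/ 3 else (2 ^ (h + 1) - 2) %/ 3)%N.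
Proof.
move=> h_gt1; have := size_expo h.+1; rewrite expo_leaders // addn1 /=.
have : (2 ^ 3 <= 2 ^ h.+1)%N by rewrite leq_exp2l.
by case: (odd h) => /=; lia.
Qed.

(** * Roots of the generator polynomial *)

Section LeaderRoots.
Variables (F : finFieldType) (h : nat) (alpha : F).
Hypotheses (cardF : #|F| = (2 ^ h.*2)%N) (h_gt1 : (1 < h)%N).
Hypothesis prim_alpha : (2 ^ h.*2 - 1)%N.-primitive_root alpha.

Definition leader_roots :=
  [seq (alpha ^- k) ^+ (2 ^ i) | k <- leaders h, i <- iota 0 h.*2].

Lemma pchar2_card : 2%N \in [pchar F].
Proof. exact: card_finPcharP cardF _. Qed.

Lemma leader_inj k k' i i' :
    k \in leaders h -> k' \in leaders h -> (i < h.*2)%N -> (i' < h.*2)%N ->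
  (alpha ^- k) ^+ (2 ^ i) = (alpha ^- k') ^+ (2 ^ i') -> k = k' /\ i = i'.
Proof.
move=> kK kK' lti lti'; rewrite -!exprVn -!exprM !exprVn => /invr_inj /eqP.
by rewrite (eq_prim_root_expr prim_alpha) => /eqP; apply: coset_inj.
Qed.

Lemma uniq_leaders : uniq (leaders h).
Proof. by have := uniq_expo h.+1; rewrite expo_leaders // => /andP[]. Qed.

Lemma uniq_leader_roots : uniq leader_roots.
Proof.
apply: allpairs_uniq; rewrite ?uniq_leaders ?iota_uniq // => -[k i] [k' i'].
move=> /allpairsP[[a b] [/= aK]] + [-> ->] /allpairsP[[a' b'] [/= aK']] + [-> ->].
rewrite !mem_iota /= !add0n => lti lti'.
by case/(leader_inj aK aK' lti lti') => -> ->.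
Qed.

Lemma map_minpoly2_leader k : k \in leaders h ->
  map_poly (@F2toF F) (minpoly2 (alpha ^- k))
    = \prod_(i <- iota 0 h.*2) ('X - ((alpha ^- k) ^+ (2 ^ i))%:P).
Proof.
move=> kK; rewrite (map_minpoly2 pchar2_card (m := h.*2)) ?big_map //; first by lia.
  exact: expF_card.
rewrite map_inj_in_uniq ?iota_uniq // => i i'; rewrite !mem_iota !add0n => lti lti'.
by case/(leader_inj kK kK lti lti').
Qed.

Lemma map_prod_minpoly2 :
  map_poly (@F2toF F) (\prod_(k <- leaders h) minpoly2 (alpha ^- k))
    = \prod_(r <- leader_roots) ('X - r%:P).
Proof.
rewrite (map_F2toFE pchar2_card) rmorph_prod /leader_roots big_allpairs_dep big_seq [RHS]big_seq.
by apply: eq_bigr => k kK; rewrite -map_minpoly2_leader.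
Qed.

Lemma leader_roots_sum t :
  \sum_(k <- leaders h) Tr h.*2 ((alpha ^+ t) ^+ k)
    = \sum_(r <- leader_roots) r^-1 ^+ t.
Proof.
rewrite /leader_roots big_allpairs_dep; apply: eq_bigr => k _.
rewrite /Tr -(big_mkord xpredT (fun i => ((alpha ^+ t) ^+ k) ^+ (2 ^ i))).
rewrite /index_iota subn0; apply: eq_bigr => i _.
by rewrite -!exprVn invrK -!exprM; congr (_ ^+ _); lia.
Qed.

Lemma leader_bounds k : k \in leaders h -> (0 < k < 2 ^ h.*2 - 1)%N.
Proof.
move=> kK; have /mem_expo[ok ltk] : k \in expo h.+1.
  by rewrite expo_leaders // inE kK orbT.
have : (2 ^ h.+2 <= 2 ^ h.*2)%N by rewrite leq_exp2l //; lia.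
by rewrite expnS; move: ok ltk; case: k {kK} => //=; lia.
Qed.

Lemma alpha_neq0 : alpha != 0.
Proof.
apply/eqP=> alpha0; have := prim_expr_order prim_alpha.
rewrite alpha0 expr0n (negPf (lt0n_neq0 (prim_order_gt0 prim_alpha))).
by move/eqP; rewrite eq_sym oner_eq0.
Qed.

Lemma leader_roots_neq0 : 0 \notin leader_roots.
Proof.
apply/allpairsP=> -[[k i] [_ _ /eqP]].
by rewrite eq_sym expf_eq0 invr_eq0 expf_eq0 (negPf alpha_neq0) !andbF.
Qed.

Lemma odd_order : odd (2 ^ h.*2 - 1).
Proof. by rewrite oddB ?expn_gt0 // oddX; case: (h) h_gt1. Qed.

(** The order of [alpha] is odd, so if it divided [k * 2 ^ i] it would divide [k], which is positive
    and smaller. *)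
Lemma leader_roots_neq1 : 1 \notin leader_roots.
Proof.
apply/allpairsP=> -[[k i] [/= kK _ /eqP]].
rewrite -exprVn -exprM exprVn eq_sym invr_eq1 -(prim_order_dvd prim_alpha).
have co : coprime (2 ^ h.*2 - 1) (2 ^ i) by rewrite coprimeXr // coprimen2 odd_order.
rewrite Gauss_dvdl // => /dvdn_leq; have /andP[k_gt0 ltk] := leader_bounds kK.
by move/(_ k_gt0); rewrite leqNgt ltk.
Qed.

Lemma size_leader_roots : size leader_roots = (size (leaders h) * h.*2)%N.
Proof. by rewrite size_allpairs size_iota. Qed.

(** Together with 0 and 1 the roots are distinct elements of [F]. The strict bound lets [g] itself
    be a codeword. *)
Lemma size_leader_roots_lt : (size leader_roots < 2 ^ h.*2 - 1)%N.
Proof.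
have U : uniq (0 :: 1 :: leader_roots).
  rewrite /= inE negb_or eq_sym oner_eq0 leader_roots_neq0 leader_roots_neq1.
  exact: uniq_leader_roots.
by have := max_card (mem (0 :: 1 :: leader_roots)); rewrite (card_uniqP U) cardF /=; lia.
Qed.

(** The ratio is [alpha ^- 2], written with a natural exponent; the zeros have exponents
    [2 ^ h + 3 + 2 * j], one for each odd number from 3 to [2 ^ h - 1]. *)
Lemma leader_roots_consecutive j : (j < 2 ^ h.-1 - 1)%N ->
  (alpha ^- (3 + 2 ^ h)) * (alpha ^+ (2 ^ h.*2 - 3)) ^+ j \in leader_roots.
Proof.
move=> ltj; set N := (2 ^ h.*2)%N.
have N_gt3 : (3 <= N)%N by apply: (@leq_trans (2 ^ 2)); rewrite ?leq_exp2l //; lia.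
have -> : alpha ^+ (N - 3) = alpha ^- 2.
  apply: (mulIf (expf_neq0 2 alpha_neq0)); rewrite mulVf ?expf_neq0 ?alpha_neq0 //.
  by rewrite -exprD (_ : N - 3 + 2 = N - 1)%N ?(prim_expr_order prim_alpha) //; lia.
apply/allpairsP; exists (3 + j.*2 + 2 ^ h, 0)%N; split=> /=.
- rewrite /leaders mem_cat; apply/orP; left; apply/mapP; exists (3 + j.*2)%N => //.
  rewrite mem_filter mem_index_iota oddD odd_double /=.
  by move: ltj; rewrite -[in (2 ^ h)%N](prednK (ltnW h_gt1)) expnS; lia.
- by rewrite mem_iota; lia.
- rewrite expr1 -!exprVn -exprM -exprD; congr (_ ^+ _); lia.
Qed.

(** The gcd of [N - 1] and [N - 3] divides 2, and both are odd. *)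
Lemma prim_step : (2 ^ h.*2 - 1)%N.-primitive_root (alpha ^+ (2 ^ h.*2 - 3)).
Proof.
rewrite prim_root_exp_coprime //; have := odd_order.
have : (2 ^ 2 <= 2 ^ h.*2)%N by rewrite leq_exp2l //; lia.
move: (2 ^ h.*2)%N => N N_ge4 oN.
have -> : (N - 1 = N - 3 + 2)%N by lia.
by rewrite /coprime gcdnDl -/(coprime _ _) coprimen2; lia.
Qed.
End LeaderRoots.

(** * Generator polynomial, dimension and distance of the code *)

Theorem theorem6 (F : finFieldType) (m : nat) (alpha : F)
  (hcard : #|F| = (2 ^ m)%N)
  (hm4 : (4 <= m)%N) (hmeven : ~~ odd m)
  (halpha : (2 ^ m - 1)%N.-primitive_root alpha) :
  let v := (2 ^ m - 1)%N in
  let h := (m %/ 2)%N in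
  let f6 := fun x : F => x + x ^+ (2 ^ h) + x ^+ (2 ^ m - 2 ^ h + 1) in
  let s := fun t : nat => Tr m (f6 (alpha ^+ t + 1)) in
  let g : {poly 'F_2} :=
    if (m %% 4 == 0)%N then
      (\prod_(3 <= i < 2 ^ h | odd i) minpoly2 (alpha ^- (i + 2 ^ h)))
      * (\prod_(2 <= j < h.-1 | ~~ odd j)
           \prod_(1 <= i < 2 ^ j | odd i) minpoly2 (alpha ^- (i + 2 ^ j)))
      * minpoly2 (alpha ^- 1)
    else
      (\prod_(3 <= i < 2 ^ h | odd i) minpoly2 (alpha ^- (i + 2 ^ h)))
      * (\prod_(1 <= j < h.-1 | odd j)
           \prod_(1 <= i < 2 ^ j | odd i) minpoly2 (alpha ^- (i + 2 ^ j))) in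
  let L : nat :=
    if (m %% 4 == 0)%N then (m * ((2 ^ (m %/ 2 + 1) - 2) %/ 3))%N
    else (m * ((2 ^ (m %/ 2 + 1) - 4) %/ 3))%N in
  (forall p : {poly 'F_2}, is_seq_minpoly s p <-> p = g) /\
  (size g).-1 = L /\
  #|cyclic_code v g| = (2 ^ (v - L))%N /\
  (2 ^ ((m - 2) %/ 2) <= min_dist (cyclic_code v g) <= L + 1)%N.
Proof.
move=> v h f6 s g L.
have mE : m = h.*2 by rewrite /h; lia.
have h_gt1 : (1 < h)%N by lia.
have oh : (m %% 4 == 0)%N = ~~ odd h by rewrite mE; lia.
clearbody h; subst m.
have char2 := pchar2_card hcard; pose R := leader_roots h alpha.
have UR : uniq R by apply: uniq_leader_roots.
have gE : g = \prod_(k <- leaders h) minpoly2 (alpha ^- k).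
  by rewrite (prod_leaders (fun k => minpoly2 (alpha ^- k))) // /g oh; case: (odd h).
have mapg : map_poly (@F2toF F) g = \prod_(r <- R) ('X - r%:P).
  by rewrite gE map_prod_minpoly2.
have szR : size R = L.
  rewrite size_leader_roots size_leaders // /L oh mulnC.
  by rewrite (_ : h.*2 %/ 2 = h)%N; [case: (odd h) | lia].
have szg : size g = L.+1 by rewrite (size_root_list char2 mapg) szR.
have nzg : g != 0 by apply: root_list_neq0 mapg.
have ltL : (L < v)%N by rewrite -szR; apply: size_leader_roots_lt.
split; [|split; [|split]].
- move=> p; apply: (seq_minpolyP char2 UR mapg) => [|t].
    exact: leader_roots_neq0.
  by rewrite -leader_roots_sum //; apply: Tr_f6.
- by rewrite szg.
- by rewrite card_cyclic_code // szg // ltnS ltnW.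
rewrite addn1 -szg min_dist_cyclic_le ?szg // andbT.
have -> : ((h.*2 - 2) %/ 2 = h.-1)%N by lia.
have le_hv : (2 ^ h.-1 <= v)%N.
  have : (2 ^ h.-1 < 2 ^ h.*2)%N by rewrite ltn_exp2l //; lia.
  by rewrite /v; lia.
apply: min_dist_ge => //.
(* The designed distance is [2 ^ h.-1], one more than the number of zeros in progression. *)
apply: (@bch_bound F (alpha ^- (3 + 2 ^ h)) (alpha ^+ (2 ^ h.*2 - 3))) => //.
- by rewrite invr_eq0 expf_eq0 (negPf (alpha_neq0 halpha)) andbF.
- exact: prim_step.
move=> j; rewrite -subn1 => ltj; rewrite mapg root_prod_XsubC.
exact: leader_roots_consecutive.
Qed.
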